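(* Let $(A,B,C)$ be a primitive Z-reduced form of discriminant $\Delta$. Then the quadratic irrationality $$\xi=\frac{B-2A+\sqrt{\Delta}}{2A}$$ has a purely periodic Denjoy continued fraction, and its minimal period is obtained from the binary string $\sigma((A,B,C))$ by replacing each $0$ by $01$.
   Context: A form $(A,B,C)$ means $Ax^2+Bxy+Cy^2$ with $A,B,C\in\mathbb{Z}$; its discriminant is $\Delta=B^2-4AC$. All forms are indefinite: $\Delta$ is positive and not a square. A form is primitive if $\gcd(A,B,C)=1$. It is Z-reduced if $A,B,C>0$ and $B>A+C$; $Z$ is the set of Z-reduced forms. Denjoy continued fractions: a Denjoy continued fraction is an expression $q_1+\cfrac{1}{q_2+\cfrac{1}{\ddots}}$ in which all quotients are $0$ or $1$ and no two consecutive quotients are $0$. Each irrational $\xi>0$ expands uniquely: set $\xi_0=\xi$, and for $n\ge1$ let $q_n=0$ if $\xi_{n-1}<1$, $q_n=1$ if $\xi_{n-1}>1$, and $\xi_n=\frac{1}{\xi_{n-1}-q_n}$. Periods refer to the quotient sequence $(q_1,q_2,\dots)$. Fundamental solution: for a positive nonsquare discriminant $\Delta$, the fundamental solution of $|t^2-\Delta u^2|=4$ is the solution $(t,u)$ in positive integers with $u$ minimal (for $\Delta=5$, where $(1,1)$ and $(3,1)$ both have $u=1$, it is $(1,1)$). Map $\beta$: for $f=(A,B,C)\in Z$ of discriminant $\Delta$ with fundamental solution $(t,u)$, set $z=\frac{t+Bu}{2}$ (an integer) and expand $\frac{z}{z-Au}$ as a finite regular continued fraction with positive integer partial quotients $q_1,\dots,q_l$,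 choosing between the two possible expansions so that $l$ is even if $t^2-\Delta u^2=-4$ and odd otherwise; $\beta(f)=(q_1,\dots,q_l)$, and always $l\ge2$. Map $\sigma$: for a sequence of positive integers of length $l\ge2$ let $\mathrm{sb}((q_1,\dots,q_l))=0^{q_1-1}1\,0^{q_2-1}1\cdots1\,0^{q_l-1}$, a binary string. Set $\sigma(f)=\mathrm{sb}(\beta(f))$. *)

(* Defs.v *)
From HB Require Import structures.
From mathcomp Require Import all_boot all_order all_algebra.
From mathcomp Require Import boolp classical_sets reals.

Set Implicit Arguments.
Unset Strict Implicit.
Unset Printing Implicit Defensive.

Import Order.TTheory GRing.Theory Num.Theory.
Local Open Scope ring_scope.

(* The binary quadratic form A x^2 + B x y + C y^2. *)
Record form := Form { fA : int; fB : int; fC : int }.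

Definition disc (f : form) : int := fB f ^+ 2 - 4 * fA f * fC f.

Definition indefinite (f : form) : Prop :=
  0 < disc f /\ ~ (exists n : int, disc f = n ^+ 2).

Definition primitive (f : form) : Prop :=
  gcdz (gcdz (fA f) (fB f)) (fC f) = 1.

Definition Zreduced (f : form) : Prop :=
  [/\ 0 < fA f, 0 < fB f, 0 < fC f & fA f + fC f < fB f].

Definition pell4_solution (D t u : int) : Prop :=
  [/\ 0 < t, 0 < u & `|t ^+ 2 - D * u ^+ 2| = 4].

(* Two solutions with the same u and different t satisfy t^2 - t'^2 = 8 up to
   exchange, so that D u^2 = 5: the last clause is the only tie to break. *)
Definition is_fundamental_solution (D t u : int) : Prop :=
  [/\ pell4_solution D t u,
      forall t' u' : int, pell4_solution D t' u' -> u <= u'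
    & D = 5 -> t = 1].

(* For D > 0 nonsquare and congruent to 0 or 1 modulo 4 there is exactly one
   fundamental solution; the default value (0, 0) is junk. *)
Definition fundamental_solution (D : int) : int * int :=
  xget (0, 0) [set tu : int * int | is_fundamental_solution D tu.1 tu.2]%classic.

(* cfrac [:: q_1; ...; q_l] = q_1 + 1/(q_2 + ... + 1/q_l) when l >= 1; the
   convention 0^-1 = 0 makes the innermost term equal to q_l. *)
Definition cfrac (s : seq nat) : rat :=
  foldr (fun (q : nat) (x : rat) => q%:R + x^-1) 0 s.

Definition is_expansion (s : seq nat) (x : rat) : Prop :=
  [/\ (0 < size s)%N, all (fun q => 0 < q)%N s & cfrac s = x].

(* The division by 2 is exact since t = B u modulo 2.  A rational number > 1
   has exactly one expansion of each parity, so xget picks the only candidate. *)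
Definition beta (f : form) : seq nat :=
  let D := disc f in
  let: (t, u) := fundamental_solution D in
  let z := ((t + fB f * u) %/ 2)%Z in
  xget [::] [set s : seq nat |
    is_expansion s (z%:~R / (z - fA f * u)%:~R) /\
    odd (size s) = (t ^+ 2 - D * u ^+ 2 != - 4)]%classic.

(* Binary strings are sequences of booleans: false is 0 and true is 1. *)
Fixpoint sb (s : seq nat) : seq bool :=
  match s with
  | [::] => [::]
  | [:: q] => nseq q.-1 false
  | q :: s' => nseq q.-1 false ++ true :: sb s'
  end.

Definition sigma (f : form) : seq bool := sb (beta f).

Definition subst01 (w : seq bool) : seq bool :=
  flatten [seq if b then [:: true] else [:: false; true] | b <- w].

Section Denjoy.
Variable R : realType.

Definition denjoy_quotient (x : R) : bool := 1 < x.

Definition denjoy_next (x : R) : R := (x - (denjoy_quotient x)%:R)^-1.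

(* Indexed from 0: denjoy xi n is the quotient q_(n+1) of the expansion of the
   positive irrational number xi. *)
Definition denjoy (xi : R) (n : nat) : bool :=
  denjoy_quotient (iter n denjoy_next xi).

End Denjoy.

Definition is_period (q : nat -> bool) (p : nat) : Prop :=
  (0 < p)%N /\ forall n : nat, q (n + p)%N = q n.

Definition purely_periodic (q : nat -> bool) : Prop :=
  exists p : nat, is_period q p.

Definition is_minimal_period (q : nat -> bool) (w : seq bool) : Prop :=
  [/\ is_period q (size w),
      forall p : nat, is_period q p -> (size w <= p)%N
    & w = mkseq q (size w)].

(* Main.v *)
Require Import Defs.
From HB Require Import structures.
From mathcomp Require Import all_boot all_order all_algebra.
From mathcomp Require Import boolp classical_sets reals.
From mathcomp Require Import ring lra zify.

(** The Denjoy expansion is an ordinary continued fraction in which the quotient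
    0 is allowed.  A quotient 0 merges its two neighbours, [..., a, 0, b, ...] =
    [..., a + b, ...], so that 1 (01)^(q-1) stands for the single quotient q.
    Hence the word w obtained from sigma(f) by replacing 0 by 01, once preceded
    by 1, is just beta(f) = (q_1, ..., q_l) written with ones ([cfmx_sb]).

    The product of the matrices [[q, 1], [1, 0]] over beta(f) has its first
    column dictated by the rational number z / (z - Au), and the parity of l
    fixes its determinant; the second column is then forced ([cfmx_beta]).
    Removing the leading quotient 1, the matrix of w turns out to be the
    automorph, attached to the fundamental solution (t, u), of the form
    g = (A, 2A-B, A-B+C), whose positive root is xi.  It fixes xi, and a value
    written as a word in 01 and 1 applied to a positive number has that word as
    its first Denjoy digits ([digits_cf_tail]); hence w is a period.

    For minimality, a period p of the digits is a return time of xi under the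
    Denjoy map: otherwise xi and its p-th iterate would be two positive fixed
    points of one nonnegative matrix, roots of one form whose roots have
    opposite signs ([digit_period_returns]).  Each return time gives an
    automorph of g, that is a solution of the Pell equation
    ([returning_orbit_pell]).  If p were shorter than w, then p and |w| - p
    would be return times, with solutions (t1, u1) and (t2, u2) whose product is
    (t, u): 2u = t1 u2 + t2 u1 and u1, u2 >= u.  This leaves only
    t1 = t2 = 1, discriminant 5 and t = 3, excluded by the choice of t = 1 there
    ([returning_time_minimal]).

    The Pell equation is solvable by the same mechanism: along the orbit of xi
    the forms keep their discriminant and the sign of their outer coefficients,
    so only finitely many occur and the orbit returns somewhere
    ([orbit_returns]). *)

Set Implicit Arguments.
Unset Strict Implicit.
Unset Printing Implicit Defensive.

Import Order.TTheory GRing.Theory Num.Theory.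
Local Open Scope ring_scope.

(** * Matrices of continued fractions with quotients in nat *)

(** The product of the matrices [[q, 1], [1, 0]]; its entries are the
    continuants of s. *)
Definition cfmx (s : seq nat) : 'M[int]_2 :=
  \prod_(q <- s)
    \matrix_(i, j) (if (i == 0) && (j == 0) then q%:Z else (i != j)%:Z).

Lemma mulmx2E (M N : 'M[int]_2) i j :
  (M * N) i j = M i 0 * N 0 j + M i 1 * N 1 j.
Proof.
rewrite mxE !big_ord_recl big_ord0 addr0.
by congr (_ + M i _ * N _ j); apply: val_inj.
Qed.

Lemma eq_mx2 (M N : 'M[int]_2) :
  M 0 0 = N 0 0 -> M 0 1 = N 0 1 -> M 1 0 = N 1 0 -> M 1 1 = N 1 1 -> M = N.
Proof.
move=> e00 e01 e10 e11; apply/matrixP => i j.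
have ord2 (k : 'I_2) : k = 0 \/ k = 1.
  by case: k => [[|[|//]]] lt; [left | right]; apply: val_inj.
by case: (ord2 i) => ->; case: (ord2 j) => ->.
Qed.

Lemma cfmx_nil : cfmx [::] = 1.
Proof. by rewrite /cfmx big_nil. Qed.

Lemma cfmx_cat s1 s2 : cfmx (s1 ++ s2) = cfmx s1 * cfmx s2.
Proof. by rewrite /cfmx big_cat. Qed.

Lemma cfmx_cons00 q s : cfmx (q :: s) 0 0 = q%:Z * cfmx s 0 0 + cfmx s 1 0.
Proof. by rewrite /cfmx big_cons mulmx2E !mxE /= mul1r. Qed.

Lemma cfmx_cons01 q s : cfmx (q :: s) 0 1 = q%:Z * cfmx s 0 1 + cfmx s 1 1.
Proof. by rewrite /cfmx big_cons mulmx2E !mxE /= mul1r. Qed.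

Lemma cfmx_cons10 q s : cfmx (q :: s) 1 0 = cfmx s 0 0.
Proof. by rewrite /cfmx big_cons mulmx2E !mxE /= mul1r mul0r addr0. Qed.

Lemma cfmx_cons11 q s : cfmx (q :: s) 1 1 = cfmx s 0 1.
Proof. by rewrite /cfmx big_cons mulmx2E !mxE /= mul1r mul0r addr0. Qed.

Definition cfmx_consE := (cfmx_cons00, cfmx_cons01, cfmx_cons10, cfmx_cons11).

Lemma cfmx_det s :
  cfmx s 0 0 * cfmx s 1 1 - cfmx s 0 1 * cfmx s 1 0 = (-1) ^+ size s.
Proof.
elim: s => [|q s IHs]; first by rewrite cfmx_nil !mxE.
rewrite !cfmx_consE /= exprS -IHs; ring.
Qed.

Lemma cfmx_ge0 s :
  [/\ 0 <= cfmx s 0 0, 0 <= cfmx s 0 1, 0 <= cfmx s 1 0 & 0 <= cfmx s 1 1] /\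
  (0 < cfmx s 0 0 + cfmx s 0 1 /\ 0 < cfmx s 1 0 + cfmx s 1 1).
Proof.
elim: s => [|q s [[? ? ? ?] [? ?]]]; first by rewrite cfmx_nil !mxE.
rewrite !cfmx_consE; do !split; nia.
Qed.

(** This is a + 1/(0 + 1/x) = a + x, for matrices. *)
Lemma cfmx_merge a b s : cfmx (a :: 0%N :: b :: s) = cfmx (a + b :: s)%N.
Proof. by apply: eq_mx2; rewrite !cfmx_consE; lia. Qed.

Definition bits (v : seq bool) : seq nat := map nat_of_bool v.

Lemma subst01_cat v w : subst01 (v ++ w) = subst01 v ++ subst01 w.
Proof. by rewrite /subst01 map_cat flatten_cat. Qed.

Lemma cfmx_zeros k w :
  cfmx (1%N :: bits (subst01 (nseq k false ++ w))) =
  cfmx (k.+1 :: bits (subst01 w)).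
Proof.
suff H a : cfmx (a :: bits (subst01 (nseq k false ++ w))) =
    cfmx ((a + k)%N :: bits (subst01 w)) by rewrite H add1n.
elim: k a => [|k IHk] a /=; first by rewrite addn0.
by rewrite cfmx_merge IHk -addnA add1n.
Qed.

Lemma cfmx_cons q s : cfmx (q :: s) = cfmx [:: q] * cfmx s.
Proof. exact: (cfmx_cat [:: q]). Qed.

(** Each block 1 (01)^(q-1) collapses to the quotient q.  The strings of
    zeros of [sb s] are separated by a 1, and the additional 1 in front supplies
    the one that the first block lacks. *)
Lemma cfmx_sb s : s != [::] -> all (fun q => 0 < q)%N s ->
  cfmx (1%N :: bits (subst01 (sb s))) = cfmx s.
Proof.
elim: s => [//|q [|q' s] IHs] _ /= /andP[q0 s0].
  by rewrite -[nseq _ _]cats0 cfmx_zeros prednK.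
by rewrite cfmx_zeros prednK // cfmx_cons [RHS]cfmx_cons -IHs.
Qed.

(** * Continued fractions with a real tail and Denjoy digits *)

Definition cf_tail (R : fieldType) (s : seq nat) (y : R) : R :=
  foldr (fun q x => q%:R + x^-1) y s.

Lemma cfmx_den_gt0 (R : realFieldType) (s : seq nat) (y : R) : 0 < y ->
  0 < (cfmx s 0 0)%:~R * y + (cfmx s 0 1)%:~R /\
  0 < (cfmx s 1 0)%:~R * y + (cfmx s 1 1)%:~R.
Proof.
move=> y0; have [[? ? ? ?] [? ?]] := cfmx_ge0 s.
have H (a b : int) : 0 <= a -> 0 <= b -> 0 < a + b ->
    0 < a%:~R * y + b%:~R :> R.
  move=> a0 b0 ab.
  have a0' : 0 <= a%:~R :> R by rewrite ler0z.
  have b0' : 0 <= b%:~R :> R by rewrite ler0z.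
  have : 0 < (a + b)%:~R :> R by rewrite ltr0z.
  by rewrite intrD; nra.
by split; apply: H.
Qed.

Lemma cf_tail_cfmx (R : realFieldType) (s : seq nat) (y : R) : 0 < y ->
  cf_tail s y * ((cfmx s 1 0)%:~R * y + (cfmx s 1 1)%:~R) =
  (cfmx s 0 0)%:~R * y + (cfmx s 0 1)%:~R.
Proof.
move=> y0; elim: s => [|q s IHs] /=; first by rewrite cfmx_nil !mxE /=; ring.
have [num0 den0] := cfmx_den_gt0 s y0.
have x0 : cf_tail s y != 0.
  by apply: contraTneq num0 => x0; rewrite -IHs x0 mul0r ltxx.
rewrite !cfmx_consE !intrD !intrM -pmulrn.
transitivity (q%:R * ((cfmx s 0 0)%:~R * y + (cfmx s 0 1)%:~R) +
              ((cfmx s 1 0)%:~R * y + (cfmx s 1 1)%:~R)); last by ring.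
by rewrite -IHs; field.
Qed.

Lemma cf_tail_cat (R : fieldType) (s1 s2 : seq nat) (y : R) :
  cf_tail (s1 ++ s2) y = cf_tail s1 (cf_tail s2 y).
Proof. exact: foldr_cat. Qed.

Lemma cfrac_cfmx (s : seq nat) : all (fun q => 0 < q)%N s ->
  0 < cfmx s 0 0 /\
  cfrac s = (cfmx s 0 0)%:~R / (cfmx s 1 0)%:~R.
Proof.
elim: s => [|q s IHs] /=.
  (* The empty expansion has value 0, and the identity matrix gives 1 / 0 = 0. *)
  by move=> _; rewrite cfmx_nil !mxE /= invr0 mulr0.
case/andP=> q0 /IHs[a0 ->]; rewrite !cfmx_consE.
have [[? ? ? ?] _] := cfmx_ge0 s; split; first by nia.
have : (cfmx s 0 0)%:~R != 0 :> rat by rewrite intr_eq0 gt_eqF.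
rewrite intrD intrM /= => a0'.
by rewrite invf_div -pmulrn; field.
Qed.

Section Dynamics.
Variable R : realType.
Implicit Types x y : R.

Definition digits x n : seq bool := mkseq (denjoy x) n.

Lemma denjoyD x m n : denjoy x (m + n) = denjoy (iter m (@denjoy_next R) x) n.
Proof. by rewrite /denjoy addnC iterD. Qed.

Lemma digitsD x m n :
  digits x (m + n) = digits x m ++ digits (iter m (@denjoy_next R) x) n.
Proof.
rewrite /digits /mkseq iotaD map_cat add0n; congr (_ ++ _).
rewrite -[X in iota X]addn0 iotaDl -map_comp; apply: eq_map => i /=.
by rewrite denjoyD.
Qed.

Lemma cf_tail_digits x n :
  cf_tail (bits (digits x n)) (iter n (@denjoy_next R) x) = x.
Proof.
elim: n x => [//|n IHn] x.
rewrite -add1n digitsD /bits map_cat cf_tail_cat iterD.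
rewrite -iterD addnC iterD IHn /= /denjoy_next invrK /denjoy /=; ring.
Qed.

Lemma cf_tail_gt0 (s : seq nat) y : 0 < y -> 0 < cf_tail s y.
Proof.
move=> y0; elim: s => [//|q s IHs] /=.
by rewrite ltr_wpDl ?ler0n // invr_gt0.
Qed.

(** An arbitrary 0-1 word need not be recovered from its value, since a digit 0
    must be followed by a tail greater than 1.  In a word made of the blocks 1
    and 01 this is automatic, because every 0 is followed by a 1. *)
Lemma digits_cf_tail (w : seq bool) y (n := size (subst01 w))
    (x := cf_tail (bits (subst01 w)) y) : 0 < y ->
  digits x n = subst01 w /\ iter n (@denjoy_next R) x = y.
Proof.
move=> y0; rewrite {}/x {}/n.
elim: w => [//|b w [IHd IHi]].
rewrite -cat1s subst01_cat /bits map_cat cf_tail_cat.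
rewrite -/(bits _) -/(bits (subst01 w)).
set x := cf_tail _ y in IHd IHi *.
have x0 : 0 < x by exact: cf_tail_gt0.
set s := subst01 [:: b].
suff [Hd Hi] : digits (cf_tail (bits s) x) (size s) = s /\
    iter (size s) (@denjoy_next R) (cf_tail (bits s) x) = x.
  by rewrite size_cat digitsD Hd Hi IHd addnC iterD Hi IHi.
have x1 : 1 < 1 + x^-1 by rewrite ltrDl invr_gt0.
rewrite {}/s /digits /mkseq; case: b => /=;
  rewrite /denjoy /= /denjoy_quotient /denjoy_next /denjoy_quotient ?add0r.
  by rewrite x1 addrAC subrr add0r invrK.
have -> : (1 < (1 + x^-1)^-1) = false.
  by apply/negbTE; rewrite -leNgt invf_le1 ?(ltW x1) // (lt_trans ltr01).
by rewrite subr0 invrK x1 addrAC subrr add0r invrK.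
Qed.

End Dynamics.

(** * Positive roots of indefinite forms *)

Section Roots.
Variable R : realType.
Implicit Types (f : Defs.form) (x y : R).

(** The sign conditions say that the other root is negative, so that a form has
    at most one positive root. *)
Definition positive_root f x : Prop :=
  [/\ 0 < fA f, fC f < 0, 0 < x
    & (fA f)%:~R * x ^+ 2 + (fB f)%:~R * x + (fC f)%:~R = 0].

Lemma positive_root_uniq f x y :
  positive_root f x -> positive_root f y -> x = y.
Proof.
case=> a0 c0 x0 xP [_ _ y0 yP].
move: a0 c0; rewrite -(ltr0z R) -(ltrz0 R) => a0 c0.
set a := (fA f)%:~R in a0 xP yP; set b := (fB f)%:~R in xP yP.
set c := (fC f)%:~R in c0 xP yP.
have : (x - y) * (a * (x + y) + b) = 0 by lra.
move/eqP; rewrite mulf_eq0 subr_eq0 => /orP[/eqP //|/eqP abs].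
have : x * (a * (x + y) + b) = 0 by rewrite abs mulr0.
have : 0 < a * x * y by rewrite !mulr_gt0.
lra.
Qed.

(** A rational root -l/k would make the discriminant the square of the rational
    number (2Al - Bk)/k, hence of an integer. *)
Lemma positive_root_irrational f x (k l : int) :
  indefinite f -> positive_root f x -> k%:~R * x + l%:~R = 0 -> k = 0 /\ l = 0.
Proof.
case=> _ nsq [_ _ _ xP] klP.
have [k0|k0] := eqVneq k 0.
  split=> //; apply/eqP; rewrite -(intr_eq0 R) -klP k0; apply/eqP; ring.
case: nsq.
have E : (2 * fA f * l - fB f * k) ^+ 2 = disc f * k ^+ 2.
  apply: (@intr_inj R); rewrite /disc !(rmorphM, rmorphB, rmorphXn) /=.
  have -> : l%:~R = - (k%:~R * x) by lra.
  apply/eqP; rewrite -subr_eq0; apply/eqP.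
  transitivity (4 * (fA f)%:~R * k%:~R ^+ 2 *
      ((fA f)%:~R * x ^+ 2 + (fB f)%:~R * x + (fC f)%:~R)); first by ring.
  by rewrite xP mulr0.
have /dvdzP[n nP] : (k %| 2 * fA f * l - fB f * k)%Z.
  have : (k ^+ 2 %| (2 * fA f * l - fB f * k) ^+ 2)%Z by rewrite E dvdz_mull.
  by rewrite !dvdzE !abszX dvdn_pexp2r.
exists n; apply: (@mulIf _ (k ^+ 2)); first by rewrite expf_neq0.
by rewrite -E nP exprMn.
Qed.

Lemma primitiveP f :
  primitive f <->
  exists x y z : int, x * fA f + y * fB f + z * fC f = 1.
Proof.
rewrite /primitive; split=> [g1|[x [y [z xyz]]]].
  have [u [v uv]] := Bezoutz (fA f) (fB f).
  have [w [z wz]] := Bezoutz (gcdz (fA f) (fB f)) (fC f).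
  exists (w * u), (w * v), z; rewrite -g1 -wz -uv; ring.
set g := gcdz _ _.
have gC : (g %| fC f)%Z by exact: dvdz_gcdr.
have gAB : (g %| gcdz (fA f) (fB f))%Z by exact: dvdz_gcdl.
have gA : (g %| fA f)%Z := dvdz_trans gAB (dvdz_gcdl _ _).
have gB : (g %| fB f)%Z := dvdz_trans gAB (dvdz_gcdr _ _).
have : (g %| x * fA f + y * fB f + z * fC f)%Z.
  by rewrite !rpredD // dvdz_mull.
by rewrite xyz dvdz1 => /eqP/(congr1 Posz).
Qed.

(** Fixing x means that x is a root of the form (M10, M11 - M00, -M01).  As x is
    irrational, this form is proportional to f, and as f is primitive the factor
    is an integer. *)
Lemma root_stabilizer f x (M : 'M[int]_2) :
  indefinite f -> primitive f -> positive_root f x ->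
  x * ((M 1 0)%:~R * x + (M 1 1)%:~R) = (M 0 0)%:~R * x + (M 0 1)%:~R ->
  exists u,
    [/\ M 1 0 = fA f * u, M 1 1 - M 0 0 = fB f * u & M 0 1 = - fC f * u].
Proof.
move=> fi /primitiveP[p [q [r bez]]] fx Mx.
have [a0 _ _ xP] := fx.
(* Eliminating x ^+ 2 between the two equations leaves a linear one. *)
have [] := @positive_root_irrational f x
    (M 1 0 * fB f - fA f * (M 1 1 - M 0 0)) (M 1 0 * fC f + fA f * M 0 1) fi fx.
  rewrite !(rmorphB, rmorphD, rmorphM) /=.
  transitivity
    ((M 1 0)%:~R * ((fA f)%:~R * x ^+ 2 + (fB f)%:~R * x + (fC f)%:~R) -
     (fA f)%:~R * (x * ((M 1 0)%:~R * x + (M 1 1)%:~R) -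
                   ((M 0 0)%:~R * x + (M 0 1)%:~R))); first by ring.
  by rewrite xP Mx subrr !mulr0 subr0.
move=> eB eC.
have a0' : fA f != 0 by rewrite gt_eqF.
set u := p * M 1 0 + q * (M 1 1 - M 0 0) - r * M 0 1.
have uA : M 1 0 = fA f * u.
  transitivity (fA f * u + q * (M 1 0 * fB f - fA f * (M 1 1 - M 0 0))
                + r * (M 1 0 * fC f + fA f * M 0 1)).
    rewrite -[LHS]mulr1 -bez /u; ring.
  by rewrite eB eC !mulr0 !addr0.
exists u; split=> //.
  apply: (mulfI a0'); rewrite uA in eB; lia.
apply: (mulfI a0'); rewrite uA in eC; lia.
Qed.

(** Substituting x = q + 1/y in f(x, 1) = 0 and clearing denominators; the sign
    is chosen to keep the leading coefficient positive. *)
Definition next_form f (q : int) : Defs.form :=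
  Form (- (fA f * q ^+ 2 + fB f * q + fC f)) (- (2 * fA f * q + fB f)) (- fA f).

Lemma disc_next_form f q : disc (next_form f q) = disc f.
Proof. rewrite /disc /=; ring. Qed.

Lemma primitive_next_form f q : primitive f -> primitive (next_form f q).
Proof.
move=> /primitiveP[x [y [z xyz]]]; apply/primitiveP => /=.
exists (- z), (- (y - z * q)), (- (x - 2 * (y - z * q) * q - z * q ^+ 2)).
rewrite -xyz; ring.
Qed.

Lemma positive_root_neq1 f x : indefinite f -> positive_root f x -> x != 1.
Proof.
move=> fi fx; apply/eqP => x1.
by have [] := @positive_root_irrational f x 1 (-1) fi fx _; rewrite // x1; ring.
Qed.

Lemma positive_root_next f x : indefinite f -> positive_root f x ->
  positive_root (next_form f (denjoy_quotient x)%:Z) (denjoy_next x).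
Proof.
move=> fi fx; have x1 := positive_root_neq1 fi fx.
have [a0 c0 x0 xP] := fx.
have q0 : denjoy_quotient x%R = true -> 1 < x by [].
set q := denjoy_quotient x in q0 *.
have r0 : 0 < x - q%:R.
  move: q0; case: q => [/(_ erefl) lt1|_]; first by rewrite subr_gt0.
  by rewrite subr0.
have a0' : 0 < (fA f)%:~R :> R by rewrite ltr0z.
have c0' : (fC f)%:~R < 0 :> R by rewrite ltrz0.
split=> /=.
- case: (boolP q) q0 => [_ /(_ erefl) lt1|].
    rewrite -(ltr0z R) !(rmorphN, rmorphD, rmorphM, rmorphXn) /=.
    rewrite -(pmulr_rgt0 _ x0).
    (* x f(1) = - (x - 1) (a x - c), because f(x) = 0. *)
    have : 0 < (x - 1) * ((fA f)%:~R * x - (fC f)%:~R).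
      by rewrite mulr_gt0 ?subr_gt0 // (lt_trans c0') // mulr_gt0.
    lra.
  lia.
- lia.
- by rewrite /denjoy_next invr_gt0.
- rewrite /denjoy_next -/q !(rmorphN, rmorphD, rmorphM, rmorphXn) /=.
  have r0' : x - q%:R != 0 by rewrite gt_eqF.
  by rewrite -[RHS](mulr0 (- (x - q%:R)^-2)) -xP -pmulrn; field.
Qed.

Lemma denjoy_no_two_zeros f x : indefinite f -> positive_root f x ->
  denjoy x 0 || denjoy x 1.
Proof.
move=> fi fx; have x1 := positive_root_neq1 fi fx; have [_ _ x0 _] := fx.
rewrite /denjoy /= /denjoy_next /denjoy_quotient.
case: ltP => //= x_le1; rewrite subr0 invf_gt1 //.
by rewrite lt_neqAle x1.
Qed.

End Roots.

(** * Return times of the Denjoy map and the Pell equation *)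

(** The quotient 0 only permutes the rows, while the quotient 1 increases the
    sum of the entries.  This separates the matrix of a word with a digit 1 from the
    identity and from the exchange of coordinates, whose entries sum to 2. *)
Lemma cfmx_bits_sum (v : seq bool) (M := cfmx (bits v)) : true \in v ->
  3 <= M 0 0 + M 0 1 + M 1 0 + M 1 1.
Proof.
rewrite {}/M; elim: v => [//|b v IHv]; rewrite in_cons /= !cfmx_consE.
have [[? ? ? ?] [? ?]] := cfmx_ge0 (bits v).
case: b => /= [_|/IHv]; lia.
Qed.

Section Periods.
Variable R : realType.
Implicit Types (f : Defs.form) (x y : R).
Notation next := (@denjoy_next R).

Lemma positive_root_orbit f x n :
  indefinite f -> primitive f -> positive_root f x ->
  exists g, [/\ positive_root g (iter n next x), primitive g & disc g = disc f].
Proof.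
move=> fi fp fx; elim: n => [|n [g [gx gp gD]]]; first by exists f.
have gi : indefinite g by rewrite /indefinite gD.
exists (next_form g (denjoy_quotient (iter n next x))%:Z); split.
- exact: positive_root_next.
- exact: primitive_next_form.
- by rewrite disc_next_form.
Qed.

(** The digits up to a return time multiply to an automorph of f, whose trace t
    and factor u satisfy t^2 - D u^2 = 4 det.  That t and u are nonzero comes
    from the presence of a digit 1. *)
Lemma returning_orbit_pell f x p (M := cfmx (bits (digits x p))) :
  indefinite f -> primitive f -> positive_root f x ->
  (0 < p)%N -> iter p next x = x ->
  exists t u, pell4_solution (disc f) t u /\
    [/\ M 1 0 = fA f * u, M 0 1 = - fC f * u,
        M 1 1 - M 0 0 = fB f * u & M 0 0 + M 1 1 = t].
Proof.
move=> fi fp fx p0 xp; have [a0 c0 x0 _] := fx.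
have xE := cf_tail_digits x p; rewrite xp in xE.
have := cf_tail_cfmx (bits (digits x p)) x0; rewrite xE -/M.
case/(root_stabilizer fi fp fx) => u [eA eB eC].
have M3 : 3 <= M 0 0 + M 0 1 + M 1 0 + M 1 1.
  apply: cfmx_bits_sum; apply/(nthP false); rewrite size_mkseq.
  have [d0|d0 /=] := boolP (denjoy x 0).
    by exists 0%N; rewrite ?nth_mkseq.
  have d1 : denjoy x 1.
    by have := denjoy_no_two_zeros fi fx; rewrite (negbTE d0).
  have p1 : (1 < p)%N.
    rewrite ltn_neqAle p0 andbT; apply: contraNneq d0 => p1.
    by rewrite -[x]xp -p1 -denjoyD addn0.
  by exists 1%N; rewrite ?nth_mkseq.
have [[m00 m01 m10 m11] _] := cfmx_ge0 (bits (digits x p)).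
rewrite -/M in m00 m01 m10 m11.
have Mdet := cfmx_det (bits (digits x p)); rewrite -/M in Mdet.
have det1 : M 0 0 * M 1 1 - M 0 1 * M 1 0 = 1 \/
    M 0 0 * M 1 1 - M 0 1 * M 1 0 = -1.
  by rewrite Mdet -signr_odd; case: odd; [right | left].
exists (M 0 0 + M 1 1), u; do !split => //.
- rewrite lt_neqAle addr_ge0 // andbT; apply/eqP => t0.
  have [z0 z1] : M 0 0 = 0 /\ M 1 1 = 0 by lia.
  rewrite z0 z1 in M3 det1.
  have : 0 <= (M 0 1 - 1) * (M 1 0 - 1) by rewrite mulr_ge0 // subr_ge0; nia.
  lia.
- rewrite lt_neqAle; apply/andP; split; last by rewrite -(pmulr_rge0 _ a0) -eA.
  apply/eqP => u0; rewrite -u0 !mulr0 in eA eB eC; nia.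
- have -> : (M 0 0 + M 1 1) ^+ 2 - disc f * u ^+ 2 =
      4 * (M 0 0 * M 1 1 - M 0 1 * M 1 0).
    transitivity ((M 0 0 + M 1 1) ^+ 2 - (fB f * u) ^+ 2 +
        4 * (fA f * u) * (fC f * u)); first by rewrite /disc; ring.
    rewrite -eA -eB; have -> : fC f * u = - M 0 1 by rewrite eC; ring.
    ring.
  by rewrite normrM Mdet normrX normrN1 expr1n.
Qed.

(** Pigeonhole: with a > 0 > c the equation b^2 - 4ac = D bounds a and b by D,
    and a, b and D determine c; two forms of the orbit coincide, hence so do
    their positive roots. *)
Lemma orbit_returns f x : indefinite f -> primitive f -> positive_root f x ->
  exists i p, (0 < p)%N /\ iter p next (iter i next x) = iter i next x.
Proof.
move=> fi fp fx.
have [g gP] := choice (fun n => positive_root_orbit n fi fp fx).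
pose K := `|disc f|%N.
have bnd n : 0 < fA (g n) <= K%:Z /\ - K%:Z <= fB (g n) <= K%:Z.
  have [[a0 c0 _ _] _] := gP n; rewrite /disc => D.
  have [D0 _] := fi; rewrite /disc in D D0.
  have ac : fA (g n) <= - (fA (g n) * fC (g n)) by nia.
  have bb : - fB (g n) ^+ 2 <= fB (g n) <= fB (g n) ^+ 2 by nia.
  rewrite /K /disc; have b0 := sqr_ge0 (fB (g n)); lia.
pose F (n : 'I_(K.+1 * (K + K).+1).+1) : 'I_K.+1 * 'I_(K + K).+1 :=
  (inord `|fA (g n)|%N, inord `|(fB (g n) + K%:Z)%R|%N).
have /injectivePn [i [j ij Fij]] : ~~ injectiveb F.
  apply/negP => /injectiveP/leq_card.
  by rewrite card_prod !card_ord ltnn.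
have [iN jN] := (bnd i, bnd j); move: (Fij) => [Fa Fb].
have aij : fA (g i) = fA (g j).
  move/(congr1 val): Fa; rewrite /= !inordK; lia.
have bij : fB (g i) = fB (g j).
  move/(congr1 val): Fb; rewrite /= !inordK; lia.
have [[a0 c0 xi0 xiP] _ Di] := gP i; have [[_ cj0 xj0 xjP] _ Dj] := gP j.
have cij : fC (g i) = fC (g j).
  move: Di; rewrite -Dj /disc aij bij => /addrI/oppr_inj.
  by apply: mulfI; rewrite -aij mulf_neq0 // gt_eqF.
have gij : g i = g j.
  by move: aij bij cij; case: (g i) (g j) => ? ? ? [? ? ?] /= -> -> ->.
have xij : iter i next x = iter j next x.
  have [[gi _ _] [gj _ _]] := (gP i, gP j); rewrite -gij in gj.
  exact: positive_root_uniq gi gj.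
have returns k l : (k < l)%N -> iter k next x = iter l next x ->
    exists i p, (0 < p)%N /\ iter p next (iter i next x) = iter i next x.
  move=> kl kl_eq; exists k, (l - k)%N.
  by rewrite subn_gt0 -iterD subnK // ltnW.
have [ltij|ltji|eqij] := ltngtP i j.
- exact: returns ltij xij.
- exact: returns ltji (esym xij).
- by case/eqP: ij; apply: val_inj.
Qed.

End Periods.

Lemma pell_existence (R : realType) f (x : R) :
  indefinite f -> primitive f -> positive_root f x ->
  exists t u, pell4_solution (disc f) t u.
Proof.
move=> fi fp fx; have [i [p [p0 xip]]] := orbit_returns fi fp fx.
have [g [gx gp gD]] := positive_root_orbit i fi fp fx.
have gi : indefinite g by rewrite /indefinite gD.
have [t [u [tu _]]] := returning_orbit_pell gi gp gx p0 xip.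
by exists t, u; rewrite -gD.
Qed.

Lemma fundamental_solutionP (D : int) :
  (exists t u, pell4_solution D t u) ->
  is_fundamental_solution D
    (fundamental_solution D).1 (fundamental_solution D).2.
Proof.
move=> [t [u tuP]]; rewrite /fundamental_solution.
suff [t1 [u1 H]] : exists t u, is_fundamental_solution D t u.
  by case: xgetP => [? -> //|/(_ (t1, u1))].
have [D5|nD5] := eqVneq D 5.
  by exists 1, 1; rewrite D5; do !split => //; move=> ? ? [].
pose P n := `[< exists t, pell4_solution D t n%:Z >].
have exP : exists n, P n.
  exists `|u|%N; apply/asboolP; exists t.
  by have [_ /ltW/gez0_abs -> _] := tuP.
have [n /asboolP[t1 t1P] n_min] := ex_minnP exP.
exists t1, n%:Z; split=> // [t' u' u'P|/eqP]; last by rewrite (negbTE nD5).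
have [_ u'0 _] := u'P; rewrite -(gez0_abs (ltW u'0)) lez_nat.
by apply: n_min; apply/asboolP; exists t'; rewrite gez0_abs // ltW.
Qed.

(** * The matrix of beta *)

(** Euclid's algorithm; at the last step, where the quotient is q >= 2, either
    parity is reached because q = (q - 1) + 1/1. *)
Lemma expansion_exists (a b : nat) (e : bool) : (0 < b < a)%N ->
  exists s, is_expansion s (a%:R / b%:R) /\ odd (size s) = e.
Proof.
elim/ltn_ind: b a e => b IHb a e /andP[b0 ba].
have b0' : b%:R != 0 :> rat by rewrite pnatr_eq0 -lt0n.
have aE : a%:R = (a %/ b)%:R * b%:R + (a %% b)%:R :> rat.
  by rewrite -natrM -natrD -divn_eq.
have q0 : (0 < a %/ b)%N by rewrite divn_gt0 // ltnW.
have [r0|r0] := posnP (a %% b).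
  have -> : a%:R / b%:R = (a %/ b)%:R :> rat by rewrite aE r0; field.
  have q1 : (1 < a %/ b)%N.
    move: ba (divn_eq a b) q0; rewrite r0.
    by case: (a %/ b)%N => [|[|]] //; lia.
  case: e.
    by exists [:: (a %/ b)%N]; do !split; rewrite //= ?q0 // invr0 addr0.
  have q1' : (0 < (a %/ b).-1)%N by rewrite -ltnS prednK.
  exists [:: (a %/ b).-1; 1%N]; do !split; rewrite //= ?q1' //.
  by rewrite invr0 addr0 invr1 natr1 prednK.
have rb : (a %% b < b)%N by rewrite ltn_mod.
have [|s [[s0 spos sE] sodd]] := IHb _ rb b (~~ e); first by rewrite r0.
exists (a %/ b :: s)%N; do !split; rewrite //= ?q0 ?sodd ?negbK //.
have r0' : (a %% b)%:R != 0 :> rat by rewrite pnatr_eq0 -lt0n.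
by rewrite -/(cfrac s) sE aE; field; rewrite r0' b0'.
Qed.

Lemma cfmx_right_column s : s != [::] -> all (fun q => 0 < q)%N s ->
  0 < cfmx s 0 1 <= cfmx s 0 0.
Proof.
move=> s0 spos.
suff : 0 < cfmx s 0 1 <= cfmx s 0 0 /\ cfmx s 1 1 <= cfmx s 1 0 by case.
elim: s s0 spos => [//|q [|q' s] IHs] _ /andP[q0 spos].
  rewrite !cfmx_consE cfmx_nil !mxE /=; lia.
have [] := IHs isT spos; have [[? ? ? ?] _] := cfmx_ge0 (q' :: s).
by rewrite (cfmx_cons00 q) (cfmx_cons01 q) (cfmx_cons10 q) (cfmx_cons11 q); nia.
Qed.

(** The two first columns are proportional, and both are primitive because the
    determinants are units; so they agree.  With the first column and the
    determinant given, the second column is unique up to multiples of the first,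
    and the bounds on b and x leave one choice. *)
Lemma unimodular_mx_eq (a b c d x y z w e : int) :
  (e = 1 \/ e = -1) ->
  a * d - b * c = e -> z * y - x * w = e -> a * w = z * c ->
  0 < a -> 0 < b <= a -> 0 < x < z ->
  [/\ a = z, b = x, c = w & d = y].
Proof.
move=> e1 abcd zyxw awzc a0 ba xz.
have e2 : e * e = 1 by case: e1 => ->.
have az : a = z.
  have E1 : z = a * (e * (z * d - b * w)).
    rewrite -[LHS]mul1r -e2 -{2}abcd.
    transitivity (e * (z * a * d - b * (z * c))); first by ring.
    by rewrite -awzc; ring.
  have E2 : a = z * (e * (a * y - x * c)).
    rewrite -[LHS]mul1r -e2 -{2}zyxw.
    transitivity (e * (a * z * y - x * (a * w))); first by ring.
    by rewrite awzc; ring.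
  have z0 : 0 < z by lia.
  have le1 k : forall m n : int, 0 < m -> 0 < n -> m = n * k -> n <= m.
    move=> m n m0 n0 mE; have k0 : 0 < k by rewrite -(pmulr_rgt0 _ n0) -mE.
    by rewrite mE ler_peMr // ltW.
  by apply/eqP; rewrite eq_le (le1 _ _ _ z0 a0 E1) (le1 _ _ _ a0 z0 E2).
have cw : c = w by apply: (@mulfI _ z); [lia | rewrite -awzc az].
have E : b - x = z * (e * ((b - x) * y - x * (d - y))).
  rewrite -[LHS]mul1r -e2 -{2}zyxw.
  have H : z * (d - y) = w * (b - x).
    apply/eqP; rewrite -subr_eq0; apply/eqP; rewrite -az -cw.
    transitivity ((a * d - b * c) - (a * y - x * c)); first by ring.
    by rewrite abcd az cw zyxw subrr.
  transitivity (e * (z * y * (b - x) - x * (w * (b - x)))); first by ring.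
  by rewrite -H; ring.
have bx : b = x.
  move: E; set k := e * _ => E.
  have : z * -1 < z * k < z * 1 by lia.
  rewrite !ltr_pM2l; [|lia..] => k1.
  have k0 : k = 0 by lia.
  by apply/eqP; rewrite -subr_eq0 E k0 mulr0.
split=> //; apply: (@mulfI _ z); [lia|].
have : a * d - b * c = z * y - x * w by rewrite abcd zyxw.
by rewrite az bx cw => /addIr.
Qed.

Lemma pell4_even f t u :
  pell4_solution (disc f) t u -> (2 %| t + fB f * u)%Z.
Proof.
case=> _ _ pell; have : (2 %| (t + fB f * u) ^+ 2)%Z.
  have -> : (t + fB f * u) ^+ 2 = (t ^+ 2 - disc f * u ^+ 2) +
      2 * (fB f ^+ 2 * u ^+ 2 - 2 * fA f * fC f * u ^+ 2 + t * fB f * u).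
    by rewrite /disc; ring.
  rewrite rpredD ?dvdz_mulr //.
  move/(congr1 absz): pell; rewrite absz_id => pell.
  by rewrite dvdzE pell.
by rewrite !dvdzE abszX Euclid_dvdX // => /andP[].
Qed.

(** For z, x = z - Cu, w = z - Au and y = (B - A - C)u, the Pell equation says
    exactly that the matrix [[z, x], [w, y]] has determinant 1 or -1, and the
    inequalities of a reduced form make its entries positive.  The parity
    required of the length of beta matches the two determinants. *)
Lemma cfmx_beta f (tu := fundamental_solution (disc f)) (t := tu.1) (u := tu.2)
    (M := cfmx (beta f)) :
  Zreduced f -> pell4_solution (disc f) t u ->
  [/\ beta f != [::], all (fun q => 0 < q)%N (beta f) &
   [/\ 2 * M 0 0 = t + fB f * u, M 0 1 = M 0 0 - fC f * u,
       M 1 0 = M 0 0 - fA f * u & M 1 1 = (fB f - fA f - fC f) * u]].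
Proof.
move=> [a0 b0 c0 bac] tuP; have [t0 u0 pell] := tuP.
rewrite {}/M.
set z := ((t + fB f * u) %/ 2)%Z.
have zE : 2 * z = t + fB f * u.
  by rewrite mulrC divzK // pell4_even.
set y := (fB f - fA f - fC f) * u.
pose x := z - fC f * u; pose w := z - fA f * u.
pose e : int := z * y - x * w.
have eE : t ^+ 2 - disc f * u ^+ 2 = - 4 * e.
  have -> : t = 2 * z - fB f * u by lia.
  rewrite /e /x /w /y /disc; ring.
have e1 : e = 1 \/ e = -1 by lia.
have z2 : 2 <= z by nia.
have y0 : 0 < y by rewrite mulr_gt0 //; lia.
have yz : z <= z * y by rewrite ler_peMr //; lia.
have xw0 : 0 < x * w by lia.
have [x0 w0] : 0 < x /\ 0 < w.
  have xwE : x + w = t + y by rewrite /x /w /y; lia.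
  have [x0|x0] := ltrP 0 x; first by rewrite -(pmulr_rgt0 _ x0).
  have w0 : 0 <= w by lia.
  by have := mulr_le0_ge0 x0 w0; lia.
have [s0 [s0P s0odd]] : exists s, is_expansion s (z%:~R / w%:~R) /\
    odd (size s) = (t ^+ 2 - disc f * u ^+ 2 != - 4).
  have [] := @expansion_exists `|z|%N `|w|%N (t ^+ 2 - disc f * u ^+ 2 != - 4).
    have au0 : 0 < fA f * u by rewrite mulr_gt0.
    move: au0 w0; rewrite /w; set au := fA f * u => au0 w0; lia.
  move=> s; rewrite !natr_absz !gtr0_norm //; last lia.
  by exists s.
have [[s1 spos sE] sodd] : is_expansion (beta f) (z%:~R / w%:~R) /\
    odd (size (beta f)) = (t ^+ 2 - disc f * u ^+ 2 != - 4).
  rewrite /beta -/tu [tu]surjective_pairing -/t -/u -/z.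
  by case: xgetP => [? -> //|/(_ s0)[]].
have bne : beta f != [::] by rewrite -size_eq0 -lt0n.
have [m00 cE] := cfrac_cfmx spos.
have det : cfmx (beta f) 0 0 * cfmx (beta f) 1 1 -
    cfmx (beta f) 0 1 * cfmx (beta f) 1 0 = e.
  by rewrite cfmx_det -signr_odd sodd eE; case: e1 => ->.
have m10 : cfmx (beta f) 1 0 != 0.
  apply/eqP => m10; move: cE; rewrite sE m10 invr0 mulr0 => /eqP.
  by rewrite mulf_eq0 invr_eq0 !intr_eq0; lia.
have [] := @unimodular_mx_eq _ _ _ _ x y z w e e1 det erefl _ m00
  (cfmx_right_column bne spos).
- move: cE; rewrite sE => /eqP; rewrite eqr_div ?intr_eq0 ?m10 //; last lia.
  by rewrite -!intrM eqr_int => /eqP ->; rewrite mulrC.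
- by rewrite /x x0 gtrBl mulr_gt0.
by move=> -> -> -> ->.
Qed.

(** * Periods of the digit sequence *)

(** The form Ax^2 - Bx + C has the roots (B +- sqrt D)/2A; it is translated by 1
    here.  Being reduced, B > A + C, says that 1 separates its two roots. *)
Lemma positive_root_shift (R : realType) (A B C : int)
    (D := disc (Form A B C))
    (x : R := (B%:~R - 2 * A%:~R + Num.sqrt D%:~R) / (2 * A%:~R)) :
  Zreduced (Form A B C) ->
  positive_root (Form A (2 * A - B) (A - B + C)) x.
Proof.
rewrite {}/x /positive_root /=; case=> /= A0 B0 C0 BAC.
have A0' : 0 < A%:~R :> R by rewrite ltr0z.
have DE : D%:~R = (B%:~R - 2 * A%:~R) ^+ 2 + 4 * A%:~R * (B - A - C)%:~R :> R.
  by rewrite /D /disc /= !(rmorphB, rmorphM, rmorphXn) /=; ring.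
have k0 : 0 < 4 * A%:~R * (B - A - C)%:~R :> R.
  by rewrite !mulr_gt0 // ltr0z; lia.
have D0 : 0 <= D%:~R :> R by rewrite DE addr_ge0 ?sqr_ge0 // ltW.
have sE := sqr_sqrtr D0; have s0 := sqrtr_ge0 (D%:~R : R).
set s := Num.sqrt _ in sE s0 *.
split=> //; first by lia.
  rewrite divr_gt0 ?mulr_gt0 //.
  have : `|B%:~R - 2 * A%:~R| < s.
    rewrite -(ltr_pXn2r (_ : 0 < 2)%N) ?nnegrE // sE real_normK ?num_real //.
    by rewrite DE ltrDl.
  by rewrite ltr_norml => /andP[+ _]; lra.
rewrite !(rmorphB, rmorphD, rmorphM) /=.
have A1 : A%:~R != 0 :> R by rewrite gt_eqF.
transitivity ((s ^+ 2 - D%:~R) / (4 * A%:~R)); last by rewrite sE subrr mul0r.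
rewrite /D /disc !(rmorphB, rmorphM, rmorphXn) /=; by field.
Qed.

Section DigitPeriods.
Variable R : realType.
Implicit Types (f : Defs.form) (x : R).
Notation next := (@denjoy_next R).

Lemma iter_denjoy_period x p : iter p next x = x ->
  forall n, denjoy x (n + p) = denjoy x n.
Proof. by move=> xp n; rewrite addnC denjoyD xp. Qed.

(** If p is a period of the digits and L a return time, the first pL digits of x
    and of y, the p-th iterate of x, are the same word, and pL is a return time
    for both.  So the matrix of this word fixes both; it is an automorph of f,
    and y is a positive root of f like x. *)
Lemma digit_period_returns f x L p :
  indefinite f -> primitive f -> positive_root f x ->
  (0 < L)%N -> iter L next x = x ->
  is_period (denjoy x) p -> iter p next x = x.
Proof.
move=> fi fp fx L0 xL [p0 pP].
have xpL : iter (p * L) next x = x by rewrite iterM iter_fix.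
have pL0 : (0 < p * L)%N by rewrite muln_gt0 p0.
have [t [u [[_ u0 _] [eA eC eB _]]]] := returning_orbit_pell fi fp fx pL0 xpL.
have [g [[_ _ y0 _] _ _]] := positive_root_orbit p fi fp fx.
set y := iter p next x in y0 *.
have ypL : iter (p * L) next y = y by rewrite -iterD addnC iterD xpL.
have dE : digits y (p * L) = digits x (p * L).
  by apply: eq_mkseq => n; rewrite -denjoyD addnC pP.
have yE := cf_tail_digits y (p * L); rewrite ypL dE in yE.
have := cf_tail_cfmx (bits (digits x (p * L))) y0; rewrite yE.
set M := cfmx _ in eA eB eC * => My.
apply: (positive_root_uniq (f := f) _ fx); have [a0 c0 _ _] := fx; split=> //.
have u0' : u%:~R != 0 :> R by rewrite intr_eq0 gt_eqF.
apply: (mulfI u0'); rewrite mulr0.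
have eB' : M 1 1 = M 0 0 + fB f * u by lia.
move: My; rewrite eA eC eB' !(rmorphD, rmorphM, rmorphN) /= => /eqP.
rewrite -subr_eq0 => /eqP <-; ring.
Qed.

(** An earlier return time p would split the automorph of (t, u) into a product
    of automorphs, at p and L - p, whose u-components are at least u. *)
Lemma returning_time_minimal f x L p t u :
  indefinite f -> primitive f -> positive_root f x ->
  is_fundamental_solution (disc f) t u ->
  cfmx (bits (digits x L)) 1 0 = fA f * u ->
  cfmx (bits (digits x L)) 0 0 + cfmx (bits (digits x L)) 1 1 = t ->
  iter L next x = x ->
  (0 < p)%N -> iter p next x = x -> (L <= p)%N.
Proof.
move=> fi fp fx [tuP umin D5] eA et xL p0 xp; rewrite leqNgt; apply/negP => pL.
have q0 : (0 < L - p)%N by rewrite subn_gt0.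
have xq : iter (L - p) next x = x by rewrite -{1}xp -iterD subnK // ltnW.
have [t1 [u1 [tu1 [A1 C1 B1 T1]]]] := returning_orbit_pell fi fp fx p0 xp.
have [t2 [u2 [tu2 [A2 C2 B2 T2]]]] := returning_orbit_pell fi fp fx q0 xq.
have := (umin _ _ tu1, umin _ _ tu2); case=> u1min u2min.
have [a0 _ _ _] := fx.
have ML : cfmx (bits (digits x L)) =
    cfmx (bits (digits x p)) * cfmx (bits (digits x (L - p))).
  by rewrite -cfmx_cat /bits -map_cat -[in LHS](subnKC (ltnW pL)) digitsD xp.
move: eA et; rewrite ML !mulmx2E.
set M := cfmx (bits (digits x p)) in A1 C1 B1 T1 *.
set N := cfmx (bits (digits x (L - p))) in A2 C2 B2 T2 *.
move=> eA et.
(* Doubled diagonal entries avoid dividing by 2. *)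
have [m1 m0] : 2 * M 1 1 = t1 + fB f * u1 /\ 2 * M 0 0 = t1 - fB f * u1 by lia.
have [n1 n0] : 2 * N 1 1 = t2 + fB f * u2 /\ 2 * N 0 0 = t2 - fB f * u2 by lia.
have uE : 2 * u = t1 * u2 + t2 * u1.
  have a0' : fA f != 0 by rewrite gt_eqF.
  apply: (mulfI a0').
  transitivity (M 1 0 * (2 * N 0 0) + (2 * M 1 1) * N 1 0).
    by rewrite mulrCA -eA; ring.
  by rewrite m1 n0 A1 A2; ring.
have tE : 2 * t = t1 * t2 + disc f * (u1 * u2).
  apply: (@mulfI _ 2) => //.
  transitivity ((2 * M 0 0) * (2 * N 0 0) + (2 * M 1 1) * (2 * N 1 1)
    + 4 * (M 0 1 * N 1 0 + M 1 0 * N 0 1)); first by rewrite -et; ring.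
  by rewrite m0 m1 n0 n1 A1 A2 C1 C2 /disc; ring.
have [t10 u10 pell1] := tu1; have [t20 u20 _] := tu2.
have [t0 u0 _] := tuP.
have [t11 t21] : t1 = 1 /\ t2 = 1.
  suff : t1 + t2 <= 2 by lia.
  rewrite -(ler_pM2r u0) uE mulrDl.
  by apply: lerD; rewrite ler_pM2l.
have [u1E u2E] : u1 = u /\ u2 = u by move: uE; rewrite t11 t21; lia.
(* t1 = 1 and u1 = u give 1 - D u^2 = -4, so D = 5, where t = 1 is prescribed
   while the product of the two automorphs has t = 3. *)
have [D0 _] := fi.
have [D5' u1'] : disc f = 5 /\ u = 1.
  have Du : disc f * u ^+ 2 = 5.
    have := mulr_gt0 D0 (exprn_gt0 2 u0); move: pell1; rewrite t11 u1E; lia.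
  have [u3|u3] := lerP 3 u.
    have u9 : 3 * 3 <= u * u by rewrite ler_pM.
    have : u ^+ 2 <= disc f * u ^+ 2 by rewrite ler_peMl ?sqr_ge0.
    by rewrite Du; lia.
  have [u1'|u2'] : u = 1 \/ u = 2 by lia.
    by move: Du; rewrite u1'; lia.
  by move: Du; rewrite u2'; lia.
by move: tE; rewrite (D5 D5') t11 t21 u1E u2E D5' u1'.
Qed.

End DigitPeriods.

Theorem theorem5p3 (R : realType) (A B C : int) :
  let f := Form A B C in
  indefinite f -> primitive f -> Zreduced f ->
  let xi : R := (B%:~R - 2 * A%:~R + Num.sqrt (disc f)%:~R) / (2 * A%:~R) in
  purely_periodic (denjoy xi) /\
  is_minimal_period (denjoy xi) (subst01 (sigma f)).
Proof.
move=> f fi fp fZ xi; have [A0 _ _ _] := fZ.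
pose g := Form A (2 * A - B) (A - B + C).
have gx : positive_root g xi by exact: positive_root_shift.
have gD : disc g = disc f by rewrite /disc /=; ring.
have gi : indefinite g by rewrite /indefinite gD.
have gp : primitive g.
  move/primitiveP: fp => [x [y [z xyz]]]; apply/primitiveP.
  exists (x + 2 * y + z), (- (y + z)), z; rewrite -[RHS]xyz /=; ring.
have tuP : is_fundamental_solution (disc f) (fundamental_solution (disc f)).1
    (fundamental_solution (disc f)).2.
  by apply: fundamental_solutionP; rewrite -gD; exact: pell_existence gx.
move: tuP (cfmx_beta (f := f) fZ).
set t := _.1; set u := _.2 => tuP /(_ _)[|s0 spos]; first by case: tuP.
have [[_ u0 _] _ _] := tuP.
have := cfmx_sb s0 spos; rewrite -/(sigma f).
set w := subst01 (sigma f) => <-; rewrite !cfmx_consE.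
set M := cfmx (bits w) => -[m0 m01 m00 m11].
have M10 : M 1 0 = A * u by move: m00 => /=; lia.
have [dw xw] : digits xi (size w) = w /\ iter (size w) (@denjoy_next R) xi = xi.
  have [_ _ x0 xP] := gx.
  suff xE : cf_tail (bits w) xi = xi.
    by have := digits_cf_tail (sigma f) x0; rewrite -/w xE.
  have [_ den0] := cfmx_den_gt0 (bits w) x0.
  apply: (mulIf (lt0r_neq0 den0)); rewrite cf_tail_cfmx // -/M.
  have -> : M 1 1 = M 0 0 + fB g * u by move: m0 m00 m01 m11 => /=; lia.
  have -> : M 0 1 = - fC g * u by move: m11 => /=; lia.
  rewrite M10; apply/eqP; rewrite -subr_eq0 !(rmorphD, rmorphM, rmorphN) /=.
  apply/eqP; rewrite -[RHS](mulr0 (- u%:~R)) -xP /=.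
  by rewrite !(rmorphD, rmorphM, rmorphN, rmorphB) /=; ring.
have w0 : (0 < size w)%N.
  rewrite lt0n size_eq0; apply/eqP => w0.
  move: M10; rewrite /M w0 cfmx_nil !mxE /=.
  by have := mulr_gt0 A0 u0; rewrite /=; lia.
have wP : is_period (denjoy xi) (size w).
  by split=> //; exact: iter_denjoy_period.
split; first by exists (size w).
split=> // p pP; have [p0 _] := pP.
apply: (returning_time_minimal gi gp gx (t := t) (u := u)) => //.
- by rewrite gD.
- by rewrite dw.
- by rewrite dw -/M; move: m0 m01 m00 m11 => /=; lia.
- exact: digit_period_returns gi gp gx w0 xw pP.
Qed.
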